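(* Let $w\ge0$ and $m\ge 0$ be integers, let $T\subset\mathbb{N}=\{1,2,\dots\}$ be finite, let $f$ be a monic polynomial over $\mathbb{F}_q$, and let $r_i\ge0$ be integers for $i\in T$. Suppose that $\sum_{i\in T}i|I_i|\le m-w$. Let $N(m,\prod_{i\in T}I_i^{r_i},\langle f\rangle)$ be the number of monic polynomials $g$ over $\mathbb{F}_q$ of degree $m$ with $\langle g\rangle=\langle f\rangle$ such that, for each $i\in T$, $g$ has exactly $r_i$ distinct monic irreducible factors of degree $i$. Then $$N\Big(m,\prod_{i\in T}I_i^{r_i},\langle f\rangle\Big)=q^{m-w}\prod_{i\in T}\binom{|I_i|}{r_i}\left(\frac1{q^{i}}\right)^{r_i}\left(1-\frac1{q^{i}}\right)^{|I_i|-r_i}.$$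
   Context: $\mathbb{F}_q$ is a finite field with $q=p^e$ elements, $p$ prime, $e\ge1$. $I_i$ is the set of monic irreducible polynomials of degree $i$ over $\mathbb{F}_q$. For a monic polynomial $f$ of degree $d(f)$ write $f=x^{d(f)}+f_1x^{d(f)-1}+\cdots+f_{d(f)}$ and set $f_j=0$ for $j>d(f)$. For the fixed integer $w\ge0$, $\langle f\rangle$ denotes $x^{d(f)}f(1/x)\bmod x^{w+1}$, i.e. the class of $1+f_1x+\cdots+f_wx^w$ modulo $x^{w+1}$. *)

(* Defs.v *)
From mathcomp Require Import all_boot all_order all_algebra.
From mathcomp Require Import finmap.

Set Implicit Arguments.
Unset Strict Implicit.
Unset Printing Implicit Defensive.

Import Order.TTheory GRing.Theory Num.Theory.

Local Open Scope ring_scope.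

Section MonicCounting.
Variable F : finFieldType.

(* x^d f(1/x), where d = (size f).-1 is the degree of f. *)
Definition recip (f : {poly F}) : {poly F} :=
  \poly_(j < size f) f`_((size f).-1 - j).

(* <f>, an element of the quotient ring F[x]/(x^(w+1)). The modulus is monic
   of size w.+2 > 1, so {poly %/ _} is the intended quotient even for w = 0. *)
Definition recip_class (w : nat) (f : {poly F}) :
    {poly %/ ('X^(w.+1) : {poly F})} :=
  in_qpoly 'X^(w.+1) (recip f).

(* <f> is the class of 1 + f_1 x + ... + f_w x^w, where f_j is the coefficient
   of x^(d - j) in f, and f_j = 0 for j > d. *)
Lemma recip_classE (w : nat) (f : {poly F}) :
  recip_class w f =
  \poly_(j < w.+1) (if (j < size f)%N then f`_((size f).-1 - j) else 0)
  :> {poly F}.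
Proof.
have mE : mk_monic ('X^(w.+1) : {poly F}) = 'X^(w.+1).
  by rewrite /mk_monic size_polyXn monicXn.
rewrite /= mE; apply/polyP => j.
have -> : Pdiv.CommonRing.rmodp (recip f) 'X^(w.+1) = take_poly w.+1 (recip f).
  have {1}-> : recip f = drop_poly w.+1 (recip f) * 'X^(w.+1)
                         + take_poly w.+1 (recip f).
    by rewrite addrC poly_take_drop.
  rewrite Pdiv.RingMonic.rmodp_addl_mul_small ?monicXn //.
  by rewrite size_polyXn ltnS size_take_poly.
by rewrite coef_take_poly !coef_poly.
Qed.

(* The set I_i, inside the finite type of polynomials of degree at most i. *)
Definition monic_irr (i : nat) : {set {poly_i.+1 F}} :=
  [set h : {poly_i.+1 F} | [&& (h : {poly F}) \is monic,
                               size (h : {poly F}) == i.+1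
                             & irreducibleb (h : {poly F})]].

Definition num_irr_factors (i : nat) (g : {poly F}) : nat :=
  #|[set h in monic_irr i | (h : {poly F}) %| g]|.

(* N(m, prod_(i in T) I_i^(r_i), c). *)
Definition num_monic (w m : nat) (T : {fset nat}) (r : nat -> nat)
    (c : {poly %/ ('X^(w.+1) : {poly F})}) : nat :=
  #|[set g : {poly_m.+1 F} | [&& (g : {poly F}) \is monic,
                                 size (g : {poly F}) == m.+1,
                                 recip_class w g == c
                               & all (fun i => num_irr_factors i g == r i) T]]|.

End MonicCounting.

(* Main.v *)
Require Import Defs.
From mathcomp Require Import all_boot all_order all_algebra.
From mathcomp Require Import finmap.
From mathcomp Require Import zify ring.

Import Order.TTheory GRing.Theory Num.Theory.
Local Open Scope ring_scope.

(** Put [n = m - w] and let [C] be the monic polynomial of degree [w] with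
    [<C> = <f>]. The polynomials [g] with [<g> = <f>] are exactly [C * X^n + l]
    with [size l <= n], and for [P] monic of degree at most [n] the condition
    [P %| C * X^n + l] fixes [l] modulo [P], so a proportion [q^-(deg P)] of
    the [l] satisfies it. Applied to products [P] of distinct irreducibles of
    total degree at most [n], this says that the divisibilities by these
    irreducibles are independent events of probability [q^-i], and the number
    of irreducible factors of degree [i] is binomial. *)

(** The solutions are exactly [rho + k * P], where [rho] is the remainder of [- G] modulo [P]. Since
    [d <= n], [rho] itself has size at most [n], and [k] ranges freely over the polynomials of size
    at most [n - d]. *)
Lemma card_npoly_dvdp (F : finFieldType) (n : nat) (P G : {poly F}) :
  P \is monic -> ((size P).-1 <= n)%N ->
  #|[set l : {poly_n F} | P %| G + l]| = (#|F| ^ (n - (size P).-1))%N.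
Proof.
move=> Pmon Pn; set d := (size P).-1.
have P0 : P != 0 by exact: monic_neq0.
have sP : size P = d.+1 by rewrite prednK // size_poly_gt0.
pose rho : {poly F} := (- G) %% P.
have srho : (size rho <= d)%N by rewrite -ltnS -sP ltn_modp.
have sz (k : {poly F}) : (size k <= n - d)%N -> (size (rho + k * P)%R <= n)%N.
  move=> sk; rewrite (leq_trans (size_polyD _ _)) // geq_max (leq_trans srho) //=.
  have [->|k0] := eqVneq k 0; first by rewrite mul0r size_poly0.
  by rewrite size_mul // sP addnS /= -(subnK Pn) leq_add2r.
pose h (k : {poly_(n - d) F}) : {poly_n F} := npolyp n (rho + (k : {poly F}) * P).
have hE k : (h k : {poly F}) = rho + (k : {poly F}) * P.
  by apply: npolypK; apply: sz; exact: size_npoly.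
rewrite -card_npoly -(card_imset predT (f := h)); last first.
  move=> k1 k2 /(congr1 val); rewrite /= !hE => /addrI /(mulIf P0) k12.
  exact: val_inj.
apply: eq_card => l; rewrite inE; apply/idP/imsetP => [Pl|[k _ ->]].
  have ldiv : (l : {poly F}) = rho + (l : {poly F}) %/ P * P.
    rewrite {1}(divp_eq l P) addrC; congr (_ + _).
    by move: Pl; rewrite /dvdp modpD addrC addr_eq0 -modpN => /eqP.
  have sk : (size ((l : {poly F}) %/ P)%R <= n - d)%N.
    by rewrite size_divp // leq_sub2r // size_npoly.
  by exists (npolyp (n - d) (l %/ P)) => //; apply: val_inj; rewrite /= hE npolypK.
rewrite hE addrA dvdp_addl ?dvdp_mull //.
by rewrite /dvdp modpD /rho modp_id -modpD subrr mod0p.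
Qed.

(* Independence, stated with [x.2] an arbitrary function of the event
   [x.1 %| G + l] for each [x] in [s]. The extra divisor [P] carries the
   induction, as [phi b = phi false + (phi true - phi false) * b]. *)
Lemma sum_dvdp_prod (F : finFieldType) (n : nat) (G : {poly F})
    (s : seq ({poly F} * (bool -> rat))) (P : {poly F}) :
  all (fun p => p \is monic) (P :: map fst s) ->
  pairwise (@coprimep F) (P :: map fst s) ->
  (\sum_(p <- P :: map fst s) (size p).-1 <= n)%N ->
  \sum_(l : {poly_n F})
     (P %| G + l)%R%:R * \prod_(p <- s) p.2 (p.1 %| G + l) =
  #|F|%:R ^+ n * #|F|%:R ^- (size P).-1 *
  \prod_(p <- s) (p.2 false * (1 - #|F|%:R ^- (size p.1).-1)
                  + p.2 true * #|F|%:R ^- (size p.1).-1).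
Proof.
have q0 : #|F|%:R != 0 :> rat.
  by rewrite pnatr_eq0 -lt0n; apply/card_gt0P; exists 0.
elim: s P => [|[p phi] s IH] P.
  move=> /andP[Pmon _] _; rewrite big_seq1 => Pn; rewrite big_nil mulr1.
  under eq_bigr do rewrite big_nil mulr1.
  rewrite -expfB_cond ?(negPf q0) // -natrX -(card_npoly_dvdp _ _ P G) //.
  rewrite -sum1dep_card natr_sum [RHS]big_mkcond.
  by apply: eq_bigr => l _; case: (P %| _).
move=> /and3P[Pmon pmon smon] /= /andP[/andP[Pp Ps] /andP[ps ss]].
rewrite big_cons /= big_cons /= => sn.
have sPp : (size (P * p)).-1 = ((size P).-1 + (size p).-1)%N.
  rewrite size_Mmonic ?monic_neq0 //.
  have := monic_neq0 pmon; have := monic_neq0 Pmon; rewrite -!size_poly_gt0.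
  by case: (size P) (size p) => [|a] [|b]//= _ _; rewrite addnS.
pose E (l : {poly_n F}) := \prod_(x <- s) x.2 (x.1 %| G + l).
(* As [P] and [p] are coprime, their two divisibility indicators multiply to that of [P * p], so the
   induction hypothesis applies to both sums, with extra divisor [P] and [P * p]. *)
transitivity (\sum_(l : {poly_n F})
    (phi false * ((P %| G + l)%R%:R * E l)
     + (phi true - phi false) * ((P * p %| G + l)%R%:R * E l))).
  apply: eq_bigr => l _; rewrite big_cons /= -/(E l) Gauss_dvdp //.
  by case: (P %| _); case: (p %| _) => /=; ring.
rewrite big_split -!mulr_sumr /= !IH /=; first 1 last.
- by rewrite rpredM // smon.
- rewrite ss andbT; apply/allP => x xs; rewrite coprimepMl.
  by rewrite (allP Ps _ xs) (allP ps _ xs).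
- by rewrite big_cons sPp -addnA.
- by rewrite Pmon.
- by rewrite Ps.
- by apply: leq_trans sn; rewrite big_cons leq_add2l leq_addl.
rewrite big_cons /= sPp; set Z := \prod_(x <- s) _.
rewrite exprD invfM; ring.
Qed.

(** Only the set [D] of actual divisors of [g] contributes. The point of the expansion is that each
    summand is a product of functions of single divisibility events, as independence requires. *)
Lemma num_irr_factorsE (F : finFieldType) (i r : nat) (g : {poly F}) :
  (num_irr_factors i g == r)%:R =
  \sum_(A : {set {poly_i.+1 F}} | (A \subset monic_irr F i) && (#|A| == r))
    \prod_(h in monic_irr F i) (((h : {poly F}) %| g)%R == (h \in A))%:R :> rat.
Proof.
set D := [set h in monic_irr F i | (h : {poly F}) %| g].
have indE (A : {set {poly_i.+1 F}}) : A \subset monic_irr F i ->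
    \prod_(h in monic_irr F i) (((h : {poly F}) %| g)%R == (h \in A))%:R
    = (A == D)%:R :> rat.
  move=> /subsetP AI; have [->|AD] := eqVneq A D.
    by apply: big1 => h hI; rewrite inE hI eqxx.
  have [h /andP[hI hA]] : exists h, (h \in monic_irr F i) &&
      (((h : {poly F}) %| g)%R != (h \in A)).
    apply/existsP; apply: contraNT AD; rewrite negb_exists => /forallP AE.
    apply/eqP/setP => h; rewrite inE; have := AE h.
    case hI: (h \in monic_irr F i) => /=; first by rewrite negbK => /eqP.
    by move=> _; apply/negP => /AI; rewrite hI.
  by rewrite (bigD1 h) //= (negPf hA) mul0r.
rewrite (eq_bigr (fun A => (A == D)%:R)) => [|A /andP[/indE]//].
rewrite big_mkcond (bigD1 D) //= big1 ?addr0 => [|A /negPf->]; last by case: ifP.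
have -> : D \subset monic_irr F i by apply/subsetP => h; rewrite inE => /andP[].
by rewrite eqxx /= -/(num_irr_factors i g); case: eqP.
Qed.

(** The sets [monic_irr F i] live in types that vary with [i]; [polyn] brings them into one list. *)
Definition monic_irrs (F : finFieldType) (T : seq nat) : seq {poly F} :=
  [seq polyn h | i <- T, h <- enum (monic_irr F i)].

Lemma monic_irrsP (F : finFieldType) (T : seq nat) (h : {poly F}) :
  reflect [/\ h \is monic, irreducible_poly h & (size h).-1 \in T]
          (h \in monic_irrs F T).
Proof.
apply: (iffP idP) => [/allpairsPdep[i [k [iT]]]|[hmon hirr hT]].
  rewrite mem_enum inE => /and3P[kmon /eqP ks /irreducibleP kirr] ->.
  by split; rewrite // ks.
have hs : size h = (size h).-1.+1 by rewrite prednK // (leq_trans _ hirr.1).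
apply/allpairsPdep; exists (size h).-1, (npolyp _ h).
have hE : (npolyp (size h).-1.+1 h : {poly F}) = h by rewrite npolypK -?hs.
by split; rewrite ?hE // mem_enum inE hE hmon -hs eqxx; apply/irreducibleP.
Qed.

(** The size separates the blocks of different degrees, so the list has no duplicates; and a monic
    irreducible that divides another one equals it. *)
Lemma monic_irrs_pairwise_coprime (F : finFieldType) (T : seq nat) :
  uniq T -> pairwise (@coprimep F) (monic_irrs F T).
Proof.
move=> uT.
have : uniq (monic_irrs F T).
  elim: T uT => // i T IH /= /andP[iT /IH uT].
  rewrite /monic_irrs /= -/(monic_irrs F T) cat_uniq uT andbT.
  rewrite map_inj_uniq ?enum_uniq /=; last exact: val_inj.
  apply/hasPn => h /monic_irrsP[_ _ hT]; apply: contra iT => /mapP[k].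
  by rewrite mem_enum inE => /and3P[_ /eqP ks _] hk; rewrite hk ks in hT.
rewrite uniq_pairwise.
apply: (@sub_in_pairwise _ (mem (monic_irrs F T))); last exact/allP.
move=> h k /monic_irrsP[hmon hirr _] /monic_irrsP[kmon kirr _] /= hk.
rewrite irreducible_poly_coprime //; apply: contra hk => dvd_hk.
rewrite -eqp_monic //; apply: kirr.2 => //.
by rewrite neq_ltn hirr.1 orbT.
Qed.

(** The list [s] holds the tests for the degrees already treated, which lets the induction on [T]
    move one degree at a time into [s]; the count itself is the case of empty [s]. *)
Lemma count_factor_pattern (F : finFieldType) (n : nat) (G : {poly F})
    (r : nat -> nat) (T : seq nat) (s : seq ({poly F} * (bool -> rat))) :
  all (fun p => p \is monic) (map fst s ++ monic_irrs F T) ->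
  pairwise (@coprimep F) (map fst s ++ monic_irrs F T) ->
  (\sum_(p <- map fst s ++ monic_irrs F T) (size p).-1 <= n)%N ->
  \sum_(l : {poly_n F})
     \prod_(p <- s) p.2 (p.1 %| G + l)
     * \prod_(i <- T) (num_irr_factors i (G + (l : {poly F})) == r i)%:R =
  #|F|%:R ^+ n *
  \prod_(p <- s) (p.2 false * (1 - #|F|%:R ^- (size p.1).-1)
                  + p.2 true * #|F|%:R ^- (size p.1).-1) *
  \prod_(i <- T)
    ('C(#|monic_irr F i|, r i)%:R
     * (1 / #|F|%:R ^+ i) ^+ r i
     * (1 - 1 / #|F|%:R ^+ i) ^+ (#|monic_irr F i| - r i)).
Proof.
elim: T s => [|i T IH] s.
  rewrite cats0 => smon scop sn.
  (* With extra divisor 1 the first indicator is always 1. *)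
  have := sum_dvdp_prod F n G s 1; rewrite size_poly1 expr0 invr1 mulr1.
  rewrite big_nil mulr1 => <-.
  - by apply: eq_bigr => l _; rewrite dvd1p mul1r big_nil mulr1.
  - by rewrite /= monic1.
  - by rewrite /= scop andbT; apply/allP => x _; exact: coprime1p.
  - by rewrite big_cons size_poly1.
(* The condition on degree [i] is summed over the possible sets [A] of divisors;
   for each [A] it is a product of indicators, which is absorbed into [s]. *)
pose t (A : {set {poly_i.+1 F}}) : seq ({poly F} * (bool -> rat)) :=
  [seq (polyn h, fun b : bool => (b == (h \in A))%:R) | h <- enum (monic_irr F i)].
have tE A : map fst (s ++ t A) ++ monic_irrs F T = map fst s ++ monic_irrs F (i :: T).
  by rewrite map_cat /t -map_comp catA.
move=> Wmon Wcop Wn.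
rewrite big_cons.
transitivity (\sum_(A : {set {poly_i.+1 F}} |
                   (A \subset monic_irr F i) && (#|A| == r i))
  \sum_(l : {poly_n F})
     \prod_(p <- s ++ t A) p.2 (p.1 %| G + l)
     * \prod_(i <- T) (num_irr_factors i (G + (l : {poly F})) == r i)%:R).
  rewrite exchange_big /=; apply: eq_bigr => l _.
  rewrite big_cons num_irr_factorsE mulrA mulr_sumr mulr_suml.
  by apply: eq_bigr => A _; rewrite big_cat big_map big_enum.
set M := \prod_(i <- T) _; set S := \prod_(p <- s) _.
set x : rat := #|F|%:R ^- i.
(* The contribution of [A] depends only on its cardinality: each member gives a factor [x], each
   other irreducible of degree [i] a factor [1 - x]. *)
transitivity (\sum_(A : {set {poly_i.+1 F}} |
                   (A \subset monic_irr F i) && (#|A| == r i))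
  #|F|%:R ^+ n * S * M * (x ^+ r i * (1 - x) ^+ (#|monic_irr F i| - r i))).
  apply: eq_bigr => A /andP[AI /eqP Ar]; rewrite IH ?tE // big_cat -/S -/M /=.
  rewrite mulrA -[RHS]mulrAC; congr (_ * _ * _).
  rewrite /t big_map big_enum /= (big_setID A) /= (setIidPr AI).
  rewrite [X in X * _](eq_bigr (fun=> x)) => [|h hA]; last first.
    have /(subsetP AI) := hA; rewrite inE => /and3P[_ /eqP-> _].
    by rewrite hA mul0r add0r mul1r.
  rewrite [X in _ * X](eq_bigr (fun=> 1 - x)) => [|h]; last first.
    rewrite in_setD [h \in monic_irr _ _]inE => /andP[/negPf-> /and3P[_ /eqP-> _]].
    by rewrite mul0r addr0 mul1r.
  by rewrite !prodr_const cardsD (setIidPr AI) Ar.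
(* If [r i] exceeds the number of irreducibles, there is no [A] and the binomial vanishes, so the
   truncated exponent is harmless. *)
have binE : #|[pred A : {set {poly_i.+1 F}} |
    (A \subset monic_irr F i) && (#|A| == r i)]| = 'C(#|monic_irr F i|, r i).
  by rewrite -cards_draws cardsE.
rewrite sumr_const binE !div1r -/x -mulr_natl.
by move: (_ ^+ r i) (_ ^+ (_ - _)) => a b; ring.
Qed.

(** Dropping the lowest [m - w] coefficients leaves the top [w + 1], which are [<g>] read backwards
    when [g] has degree [m]. *)
Lemma drop_poly_recip_class (F : finFieldType) (w m : nat) (f g : {poly F}) :
  f \is monic -> (w <= m)%N -> (size g <= m.+1)%N ->
  [&& g \is monic, size g == m.+1 & recip_class w g == recip_class w f] =
  (drop_poly (m - w) g
   == \poly_(j < w.+1) (polyn (recip_class w f))`_(w - j)).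
Proof.
move=> fmon wm gm; have f0 := monic_neq0 fmon.
apply/and3P/eqP => [[gmon /eqP sg /eqP <-]|dg].
  apply/polyP => j; rewrite coef_drop_poly coef_poly recip_classE coef_poly.
  case: ltnP => jw; last by rewrite nth_default // sg; lia.
  rewrite ltnS leq_subr sg ifT; last by lia.
  by congr (_`_ _); lia.
have gE j : (j <= w)%N -> g`_(m - j) = (polyn (recip_class w f))`_j.
  move=> jw; move/polyP/(_ (w - j)%N): dg; rewrite coef_drop_poly coef_poly.
  rewrite ltnS leq_subr subKn // => <-; congr (_`_ _); lia.
(* The constant term of [<f>] is the leading coefficient of [f]. Together with the size bound this
   forces [g] to be monic of degree [m]. *)
have gm1 : g`_m = 1.
  have := gE 0%N isT; rewrite subn0 recip_classE coef_poly /= size_poly_gt0 f0 subn0.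
  by move=> ->; exact/monicP.
have sg : size g = m.+1.
  apply/eqP; rewrite eqn_leq gm ltnNge; apply/negP => /leq_sizeP/(_ m (leqnn _)).
  by rewrite gm1 => /eqP; rewrite oner_eq0.
split; first by rewrite monicE /lead_coef sg gm1.
  by rewrite sg.
apply/eqP/val_inj; change (polyn (recip_class w g) = polyn (recip_class w f)).
apply/polyP => j; have [jw|jw] := leqP j w.
  rewrite -[RHS]gE // recip_classE coef_poly ltnS jw sg ifT //; lia.
by rewrite !recip_classE !coef_poly !ltnS leqNgt jw.
Qed.

Theorem theorem3 (F : finFieldType) (w m : nat) (T : {fset nat})
    (hT : forall i : nat, i \in T -> (0 < i)%N)
    (f : {poly F}) (hf : f \is monic) (r : nat -> nat)
    (hm : (\sum_(i <- T) (i * #|monic_irr F i|)%N)%:R <= m%:R - w%:R :> int) :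
  (num_monic m T r (recip_class w f))%:R =
  (#|F|%:R : rat) ^+ (m - w) *
  \prod_(i <- T)
    ('C(#|monic_irr F i|, r i)%:R
     * (1 / #|F|%:R ^+ i) ^+ r i
     * (1 - 1 / #|F|%:R ^+ i) ^+ (#|monic_irr F i| - r i)).
Proof.
(* The hypothesis is over the integers, so it yields [w <= m], and the natural subtraction [m - w]
   is not truncated. *)
have {hm} hm : (\sum_(i <- T) i * #|monic_irr F i| + w <= m)%N.
  by move: hm; rewrite lerBrDr -natrD ler_nat.
have wm : (w <= m)%N by apply: leq_trans hm; exact: leq_addl.
pose n := (m - w)%N.
pose C := \poly_(j < w.+1) (polyn (recip_class w f))`_(w - j).
pose G := C * 'X^n.
pose ok (g : {poly F}) := all (fun i => num_irr_factors i g == r i) T.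
have sG (l : {poly_n F}) : (size (G + (l : {poly F}))%R <= m.+1)%N.
  rewrite (leq_trans (size_polyD _ _)) // geq_max; apply/andP; split.
    rewrite (leq_trans (size_polyMleq _ _)) // size_polyXn addnS /=.
    by rewrite (leq_trans (leq_add (size_poly _ _) (leqnn _))) // addSn subnKC.
  by rewrite (leq_trans (size_npoly l)) // /n; lia.
pose h (l : {poly_n F}) : {poly_m.+1 F} := npolyp m.+1 (G + (l : {poly F})).
have hE l : polyn (h l) = G + (l : {poly F}) by exact: npolypK.
have dropG (l : {poly_n F}) : drop_poly n (G + (l : {poly F})) = C.
  by rewrite drop_polyD drop_polyMXn_id drop_poly_eq0 ?addr0 ?size_npoly.
(* The map [h] is injective, and [take_poly n] recovers [l] from [g]. *)
have -> : num_monic m T r (recip_class w f) =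
          #|[set l : {poly_n F} | ok (G + (l : {poly F}))]|.
  rewrite -(card_imset _ (f := h)); last first.
    by move=> l1 l2 /(congr1 val); rewrite /= !hE => /addrI/val_inj.
  apply: eq_card => g; rewrite inE.
  have -> : [&& polyn g \is monic, size (polyn g) == m.+1,
      recip_class w g == recip_class w f & ok g] = (drop_poly n g == C) && ok g.
    by rewrite -(drop_poly_recip_class _ _ _ _ _ hf wm (size_npoly g)) -!andbA.
  apply/andP/imsetP => [[/eqP gC okg]|[l]]; last first.
    by rewrite inE => okl ->; rewrite !hE dropG.
  have gE : polyn g = G + (npolyp n (take_poly n g) : {poly F}).
    by rewrite npolypK ?size_take_poly // /G -gC addrC poly_take_drop.
  exists (npolyp n (take_poly n g)); first by rewrite inE -gE.
  by apply: val_inj; rewrite /= hE.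
have := count_factor_pattern F n G r T [::].
rewrite /= big_nil mulr1 => <-.
- rewrite -sum1dep_card natr_sum [LHS]big_mkcond; apply: eq_bigr => l _.
  rewrite big_nil mul1r /ok.
  by elim: (enum_fset T) => [|i s IH]; rewrite ?big_nil // big_cons -IH /=;
     case: eqP => _; rewrite ?mul1r ?mul0r.
- by apply/allP => p /monic_irrsP[].
- by apply: monic_irrs_pairwise_coprime; exact: fset_uniq.
(* The irreducibles with degree in [T] have total degree equal to the sum in [hm], hence at most
   [n]. *)
rewrite big_allpairs_dep /=.
rewrite (eq_bigr (fun i => i * #|monic_irr F i|)%N); first by rewrite leq_subRL // addnC.
move=> i _; rewrite big_enum /= (eq_bigr (fun=> i)); first by rewrite sum_nat_const mulnC.
by move=> k; rewrite inE => /and3P[_ /eqP-> _].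
Qed.
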